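(* Let $T\in\mathbb{R}$, let $\lambda=(\lambda^0,\lambda^1,\dots,\lambda^d)\in\mathbb{R}^{d+1}$ have positive entries, and let $X=(X_t)_{t\le T}$ be a continuous $\mathbb{R}^d$-valued increment semimartingale with $X=A+M$, $A$ of bounded variation and $M$ an increment local martingale, such that for all $i=1,\dots,d$, $$\int_{-\infty}^Te^{-\lambda^i(T-u)}d|A^i|_u+\int_{-\infty}^Te^{-2\lambda^i(T-u)}d\langle M^i\rangle_u<\infty\quad\text{a.s.}$$ Let $\widehat{\mathbb{X}}^\lambda_T$ denote the EFM-signature over $(-\infty,T]$ of the time-augmented path $\widehat{X}_t=(t,X_t)$. Then $\widehat{\mathbb{X}}^\lambda_T$ determines $X=(X_t)_{t\le T}$ uniquely up to a constant shift; that is, if $Y$ is another such semimartingale on the same filtered probability space, with EFM-signature $\widehat{\mathbb{Y}}^\lambda_T$ of $\widehat{Y}_t=(t,Y_t)$, then for almost every $\omega$, $\widehat{\mathbb{X}}^\lambda_T(\omega)=\widehat{\mathbb{Y}}^\lambda_T(\omega)$ implies that $t\mapsto X_t(\omega)-Y_t(\omega)$ is constant on $(-\infty,T]$.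
   Context: An increment semimartingale is a process $X$ such that for each $s$, $(X_{s+t}-X_s)_{t\ge0}$ is a semimartingale with respect to $(\mathcal{F}_{s+t})_{t\ge0}$ (here up to time $T$). The components of $\widehat X$ are indexed by letters $0,1,\dots,d$, with $\widehat X^0_t=t$ and $\widehat X^i=X^i$ for $i\ge1$. For a word $v=i_1\cdots i_n$ in these letters put $\lambda^v=\sum_k\lambda^{i_k}$. The EFM-signature $\widehat{\mathbb{X}}^\lambda_t=(\widehat{\mathbb{X}}^{\lambda,v}_t)_v$, indexed by all words $v$, has components $\widehat{\mathbb{X}}^{\lambda,\varnothing}_t=1$ and $$\widehat{\mathbb{X}}^{\lambda,i_1\cdots i_n}_t=\int_{-\infty}^te^{-\lambda^{i_1\cdots i_n}(t-u)}\,\widehat{\mathbb{X}}^{\lambda,i_1\cdots i_{n-1}}_u\circ d\widehat X^{i_n}_u ,\qquad t\le T,$$ improper Stratonovich integrals (limits as the lower endpoint tends to $-\infty$), well-defined under the stated integrability condition. *)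

(* Defs.v *)
From HB Require Import structures.
From mathcomp Require Import all_boot all_order all_algebra.
From mathcomp Require Import all_classical all_reals all_analysis.
Import Order.TTheory GRing.Theory Num.Theory.
Import numFieldNormedType.Exports.
Set Implicit Arguments.
Unset Strict Implicit.
Unset Printing Implicit Defensive.
Local Open Scope classical_set_scope.
Local Open Scope ring_scope.

(** Processes are functions [R -> Omega -> R]; everything below only constrains
    their values at the times of the index set ([`]-oo, T]] or [`[s, T]]). *)

Definition filtration_upto (disp : measure_display)
    (Omega : measurableType disp) (R : realType) (T : R)
    (F : R -> set (set Omega)) : Prop :=
  [/\ forall t, t <= T -> sigma_algebra setT (F t),
      forall t, t <= T -> F t `<=` measurable
    & forall s t, s <= t -> t <= T -> F s `<=` F t].

(** [f] is measurable with respect to the sub-sigma-algebra [G]. *)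
Definition measurable_wrt (Omega : Type) (R : realType)
    (G : set (set Omega)) (f : Omega -> R) : Prop :=
  preimage_set_system setT f measurable `<=` G.

Definition adapted_on (Omega : Type) (R : realType)
    (F : R -> set (set Omega)) (s T : R) (N : R -> Omega -> R) : Prop :=
  forall t, s <= t -> t <= T -> measurable_wrt (F t) (N t).

(** The last clause is [E[N_t | F_u] = N_u], conditional expectation being
    spelled out through its defining property. *)
Definition martingale_on (disp : measure_display)
    (Omega : measurableType disp) (R : realType) (P : probability Omega R)
    (F : R -> set (set Omega)) (s T : R) (N : R -> Omega -> R) : Prop :=
  [/\ adapted_on F s T N,
      forall t, s <= t -> t <= T -> P.-integrable setT (EFin \o N t)
    & forall u t (B : set Omega), s <= u -> u <= t -> t <= T -> F u B ->
        (\int[P]_(w in B) (N t w)%:E = \int[P]_(w in B) (N u w)%:E)%E].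

(** Only the trace of a stopping time on [`[s, T]] matters, so that real values
    suffice: a value [> T] plays the role of infinity. *)
Definition stopping_time_on (Omega : Type) (R : realType)
    (F : R -> set (set Omega)) (s T : R) (tau : Omega -> R) : Prop :=
  (forall w, s <= tau w) /\
  forall t, s <= t -> t <= T -> F t [set w | tau w <= t].

Definition stopped (Omega : Type) (R : realType) (tau : Omega -> R)
    (N : R -> Omega -> R) : R -> Omega -> R :=
  fun t w => N (Num.min t (tau w)) w.

Definition continuous_local_martingale_on (disp : measure_display)
    (Omega : measurableType disp) (R : realType) (P : probability Omega R)
    (F : R -> set (set Omega)) (s T : R) (N : R -> Omega -> R) : Prop :=
  [/\ adapted_on F s T N,
      {ae P, forall w, {within `[s, T], continuous (fun t => N t w)}}
    & exists tau : nat -> Omega -> R,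
      [/\ forall n, stopping_time_on F s T (tau n),
          {ae P, forall w, nondecreasing_seq (fun n => tau n w) /\
                           exists n, T <= tau n w}
        & forall n, martingale_on P F s T
                      (stopped (tau n) (fun t w => N t w - N s w))]].

Definition continuous_semimartingale_on (disp : measure_display)
    (Omega : measurableType disp) (R : realType) (P : probability Omega R)
    (F : R -> set (set Omega)) (s T : R) (Z : R -> Omega -> R) : Prop :=
  adapted_on F s T Z /\
  exists B N : R -> Omega -> R,
    [/\ adapted_on F s T B,
        {ae P, forall w, {within `[s, T], continuous (fun t => B t w)} /\
                         bounded_variation s T (fun t => B t w)},
        continuous_local_martingale_on P F s T N
      & {ae P, forall w, forall t, s <= t -> t <= T -> Z t w = B t w + N t w}].

Definition increment (Omega : Type) (R : realType) (N : R -> Omega -> R)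
    (s : R) : R -> Omega -> R :=
  fun t w => N t w - N s w.

Definition increment_semimartingale (disp : measure_display)
    (Omega : measurableType disp) (R : realType) (P : probability Omega R)
    (F : R -> set (set Omega)) (T : R) (Z : R -> Omega -> R) : Prop :=
  forall s, s <= T -> continuous_semimartingale_on P F s T (increment Z s).

Definition increment_local_martingale (disp : measure_display)
    (Omega : measurableType disp) (R : realType) (P : probability Omega R)
    (F : R -> set (set Omega)) (T : R) (M : R -> Omega -> R) : Prop :=
  forall s, s <= T -> continuous_local_martingale_on P F s T (increment M s).

(** On [`]-oo, T]] the bracket of an increment local martingale has no origin:
    only its increments [Q_t - Q_s], the brackets at [t] of
    [(M_t - M_s)_(t >= s)], are determined. *)
Definition increment_bracket (disp : measure_display)
    (Omega : measurableType disp) (R : realType) (P : probability Omega R)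
    (F : R -> set (set Omega)) (T : R) (M Q : R -> Omega -> R) : Prop :=
  [/\ forall s, s <= T -> adapted_on F s T (increment Q s),
      {ae P, forall w,
        {within `]-oo, T], continuous (fun t => Q t w)} /\
        forall s t, s <= t -> t <= T -> Q s w <= Q t w}
    & forall s, s <= T -> continuous_local_martingale_on P F s T
        (fun t w => increment M s t w ^+ 2 - increment Q s t w)].

(** [\int_(-oo)^T exp (- l (T - u)) dV_u] *)
Definition fading_integral (R : realType) (T l : R) (V : cumulative R R) :
    \bar R :=
  (\int[lebesgue_stieltjes_measure V]_(u in `]-oo, T])
     (expR (- (l * (T - u))))%:E)%E.

(** The Stieltjes measures [d|A|] and [d<M>] on [`]-oo, T]] are those of any
    cumulative function [V] whose increments there are the variation of [A],
    resp. the increments of the bracket; the behaviour of [V] after [T] is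
    irrelevant. *)
Definition has_increments (R : realType) (T : R) (V : R -> R)
    (inc : R -> R -> \bar R) : Prop :=
  forall s t, s <= t -> t <= T -> (V t - V s)%:E = inc s t.

Definition efm_semimartingale (disp : measure_display)
    (Omega : measurableType disp) (R : realType) (P : probability Omega R)
    (F : R -> set (set Omega)) (T : R) (d : nat) (lam : 'I_d.+1 -> R)
    (X : 'I_d -> R -> {RV P >-> R}) : Prop :=
  (forall i, {ae P, forall w, {within `]-oo, T], continuous (fun t => X i t w)}}) /\
  (forall i, increment_semimartingale P F T (X i)) /\
  exists (A M : 'I_d -> R -> {RV P >-> R}) (Q : 'I_d -> R -> Omega -> R),
  forall i,
    [/\ {ae P, forall w, forall t, t <= T -> X i t w = A i t w + M i t w},
        {ae P, forall w,
          {within `]-oo, T], continuous (fun t => A i t w)} /\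
          forall s, s <= T -> bounded_variation s T (fun t => A i t w)},
        increment_local_martingale P F T (M i),
        increment_bracket P F T (M i) (Q i)
      & {ae P, forall w, exists V W : cumulative R R,
          [/\ has_increments T V
                (fun s t => total_variation s t (fun u => A i u w)),
              has_increments T W (fun s t => (Q i t w - Q i s w)%:E)
            & (fading_integral T (lam (lift ord0 i)) V +
               fading_integral T (2 * lam (lift ord0 i)) W < +oo)%E]}].

(** The partition [s = t_0 < ... < t_n = t] is encoded, as in the library's
    [itv_partition s t p], by [p = [:: t_1; ...; t_n]]. *)
Definition mesh_lt (R : realType) (s t : R) (p : seq R) (delta : R) : Prop :=
  forall n, (n < size p)%N ->
    nth t (s :: p) n.+1 - nth t (s :: p) n < delta.

Definition partition_cvg_in_probability (disp : measure_display)
    (Omega : measurableType disp) (R : realType) (P : probability Omega R)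
    (s t : R) (S : seq R -> Omega -> R) (Z : Omega -> R) : Prop :=
  forall eps eta : R, 0 < eps -> 0 < eta ->
  exists2 delta : R, 0 < delta &
    forall p, itv_partition s t p -> mesh_lt s t p delta ->
      (P [set w | (eps < `|S p w - Z w|)%R] < eta%:E)%E.

Definition left_sum (Omega : Type) (R : realType) (H X : R -> Omega -> R)
    (s t : R) (p : seq R) (w : Omega) : R :=
  let u := nth t (s :: p) in
  \sum_(0 <= n < size p) H (u n) w * (X (u n.+1) w - X (u n) w).

Definition covariation_sum (Omega : Type) (R : realType)
    (H X : R -> Omega -> R) (s t : R) (p : seq R) (w : Omega) : R :=
  let u := nth t (s :: p) in
  \sum_(0 <= n < size p)
    (H (u n.+1) w - H (u n) w) * (X (u n.+1) w - X (u n) w).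

(** [I = \int_s^t H dX] (Ito).  For the continuous adapted integrands used here
    this is the limit in probability of the left-point Riemann sums. *)
Definition ito_integral (disp : measure_display)
    (Omega : measurableType disp) (R : realType) (P : probability Omega R)
    (H X : R -> Omega -> R) (s t : R) (I : Omega -> R) : Prop :=
  partition_cvg_in_probability P s t (left_sum H X s t) I.

(** [C = <H, X>_t - <H, X>_s] *)
Definition covariation (disp : measure_display)
    (Omega : measurableType disp) (R : realType) (P : probability Omega R)
    (H X : R -> Omega -> R) (s t : R) (C : Omega -> R) : Prop :=
  partition_cvg_in_probability P s t (covariation_sum H X s t) C.

Definition stratonovich_integral (disp : measure_display)
    (Omega : measurableType disp) (R : realType) (P : probability Omega R)
    (H X : R -> Omega -> R) (s t : R) (Z : Omega -> R) : Prop :=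
  exists I C : {RV P >-> R},
    [/\ ito_integral P H X s t I, covariation P H X s t C
      & {ae P, forall w, Z w = I w + C w / 2}].

(** [Z = \int_(-oo)^t H o dX], the almost sure limit of [\int_s^t H o dX] as
    [s --> -oo].  [J] is a continuous version of the indefinite integral, so
    that the limit is taken along a continuous path in [s]. *)
Definition improper_stratonovich_integral (disp : measure_display)
    (Omega : measurableType disp) (R : realType) (P : probability Omega R)
    (H X : R -> Omega -> R) (t : R) (Z : Omega -> R) : Prop :=
  exists J : R -> {RV P >-> R},
    [/\ {ae P, forall w, {within `]-oo, t], continuous (fun u => J u w)}},
        forall r u, r <= u -> u <= t ->
          stratonovich_integral P H X r u (fun w => J u w - J r w)
      & {ae P, forall w, (fun s => J t w - J s w) @ -oo --> Z w}].

Definition time_augmented (disp : measure_display)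
    (Omega : measurableType disp) (R : realType) (P : probability Omega R)
    (d : nat) (X : 'I_d -> R -> {RV P >-> R}) (j : 'I_d.+1) :
    R -> Omega -> R :=
  fun t w => if unlift ord0 j is Some i then X i t w else t.

Definition lam_word (R : realType) (d : nat) (lam : 'I_d.+1 -> R)
    (v : seq 'I_d.+1) : R :=
  \sum_(i <- v) lam i.

(** [S] is (a continuous version of) the EFM-signature over [`]-oo, T]] of
    [Xhat]; the recursion determines it up to indistinguishability. *)
Definition efm_signature (disp : measure_display)
    (Omega : measurableType disp) (R : realType) (P : probability Omega R)
    (T : R) (d : nat) (lam : 'I_d.+1 -> R) (Xhat : 'I_d.+1 -> R -> Omega -> R)
    (S : seq 'I_d.+1 -> R -> {RV P >-> R}) : Prop :=
  [/\ forall t w, t <= T -> S [::] t w = 1,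
      forall v, {ae P, forall w,
        {within `]-oo, T], continuous (fun t => S v t w)}}
    & forall (v : seq 'I_d.+1) (i : 'I_d.+1) (t : R), t <= T ->
        improper_stratonovich_integral P
          (fun u w => expR (- (lam_word lam (rcons v i) * (t - u))) * S v u w)
          (Xhat i) t (S (rcons v i) t)].

(* Main.v *)
Require Import Defs.
From HB Require Import structures.
From mathcomp Require Import all_boot all_order all_algebra.
From mathcomp Require Import all_classical all_reals all_analysis.
From mathcomp Require Import measurable_realfun ring lra.
Import Order.TTheory GRing.Theory Num.Theory.
Import numFieldNormedType.Exports.
Local Open Scope classical_set_scope.
Local Open Scope ring_scope.

(** The component [X^i] can be read off from the words [i 0 ... 0], in which the
    space letter [i] is followed by [k] times the time letter [0].

    Multiply the component of such a word by [exp (lambda t)], [lambda] being the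
    weight of the word; this gives a path [g_k] with [g_k --> 0] at [-oo].  The
    factor [exp (- lambda (t - u))] of the fading kernel splits, and what is left
    is the plain recursion
      [d g_0 = exp (lambda^i u) o dX^i_u],
      [d g_(k+1) = exp (lambda^0 u) g_k(u) du]
    ([signature_fading_tower]).  Almost surely it can be read path by path: both
    integrals are limits in probability of trapezoidal sums
    ([stratonovich_cvg_trapezoid]), so almost surely their values lie in the
    closure of the set of all trapezoidal sums of the path
    ([cvg_in_probability_adherent]).  For an integrator that is smooth and
    nondecreasing this is enough to differentiate ([is_derive_of_adherent]).  It
    applies directly to the integrator [u], and to the integrator [X^i] after a
    summation by parts which turns it into [exp (lambda^i u)].

    Let now [h_k] be the difference of the paths [g_k] of [X] and [Y], at a sample
    point where the signatures at time [T] agree.  Then [h_k --> 0] at [-oo],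
    [h_k(T) = 0], and each [h_(k+1)] is a primitive of [exp (lambda^0 u) h_k].  In
    the variable [x = exp (lambda^0 u)] these are iterated primitives, so all the
    moments of [h_0] in [x] on the bounded interval []0, exp (lambda^0 T)]]
    vanish, and [h_0 = 0] ([iterated_primitives_eq0]).  Hence
    [exp (lambda^i u) (X^i - Y^i)] has derivative
    [lambda^i exp (lambda^i u) (X^i - Y^i)], so that [X^i - Y^i] has derivative
    zero ([path_determined]). *)

Set Implicit Arguments.
Unset Strict Implicit.
Unset Printing Implicit Defensive.

(** * Trapezoidal sums along a partition *)

(** The Stratonovich sums: the Ito sum plus half of the covariation sum. *)
Definition trapezoid (R : realType) (f g : R -> R) (s t : R) (p : seq R) : R :=
  let u := nth t (s :: p) in
  \sum_(0 <= n < size p) (f (u n) + f (u n.+1)) / 2 * (g (u n.+1) - g (u n)).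

(** What survives, at a fixed sample point, of a convergence in probability: [z]
    is approached by sums along partitions about which nothing else is known, in
    particular not that their mesh is small. *)
Definition trapezoid_adherent (R : realType) (f g : R -> R) (s t z : R) : Prop :=
  forall eps, 0 < eps ->
    exists2 p, itv_partition s t p & `|trapezoid f g s t p - z| <= eps.

Lemma trapezoid_nil (R : realType) (f g : R -> R) (s t : R) :
  trapezoid f g s t [::] = 0.
Proof. by rewrite /trapezoid big_nil. Qed.

Lemma trapezoid_cons (R : realType) (f g : R -> R) (s t x : R) (p : seq R) :
  trapezoid f g s t (x :: p) =
  (f s + f x) / 2 * (g x - g s) + trapezoid f g x t p.
Proof. by rewrite /trapezoid /= big_nat_recl. Qed.

(** The trapezoidal rule makes summation by parts exact, without the quadratic
    term of the left-point rule: this is the Stratonovich product rule. *)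
Lemma trapezoid_by_parts (R : realType) (f g : R -> R) (s t : R) (p : seq R) :
  itv_partition s t p ->
  trapezoid f g s t p = f t * g t - f s * g s - trapezoid g f s t p.
Proof.
elim: p s => [s /itv_partition_nil <-|x p ih s stp].
  by rewrite !trapezoid_nil; ring.
by rewrite !trapezoid_cons (ih _ (itv_partition_cons stp)); field.
Qed.

Lemma trapezoid_adherent_by_parts (R : realType) (f g : R -> R) (s t z : R) :
  trapezoid_adherent f g s t z ->
  trapezoid_adherent g f s t (f t * g t - f s * g s - z).
Proof.
move=> fgz eps /fgz[p stp pz]; exists p => //.
rewrite (trapezoid_by_parts _ _ stp) -normrN.
by congr (`|_| <= _): pz; ring.
Qed.

Lemma trapezoid_scale (R : realType) (c : R) (f f' g : R -> R) (s t : R)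
    (p : seq R) :
  (forall u, f' u = c * f u) ->
  trapezoid f' g s t p = c * trapezoid f g s t p.
Proof.
move=> ff'; rewrite /trapezoid mulr_sumr; apply: eq_bigr => n _.
by rewrite !ff'; ring.
Qed.

Lemma trapezoid_adherent_scale (R : realType) (c : R) (f f' g : R -> R)
    (s t z : R) :
  0 < c -> (forall u, f' u = c * f u) ->
  trapezoid_adherent f g s t z -> trapezoid_adherent f' g s t (c * z).
Proof.
move=> c0 ff' fgz eps eps0; have [|p stp pz] := fgz (eps / c).
  by rewrite divr_gt0.
exists p => //; rewrite (trapezoid_scale _ _ _ _ ff') -mulrBr normrM gtr0_norm//.
by rewrite mulrC -ler_pdivlMr.
Qed.

(** The bound depends on the partition only through its end points, which is why
    adherence suffices in what follows. *)
Lemma trapezoid_near_const (R : realType) (f g : R -> R) (a eta s t : R)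
    (p : seq R) :
  itv_partition s t p ->
  (forall u, s <= u <= t -> `|f u - a| <= eta) ->
  (forall u v, s <= u -> u <= v -> v <= t -> g u <= g v) ->
  `|trapezoid f g s t p - a * (g t - g s)| <= eta * (g t - g s).
Proof.
elim: p s => [s /itv_partition_nil <- _ _|x p ih s stp fa gmono].
  by rewrite trapezoid_nil !subrr !mulr0 subrr normr0.
have xtp := itv_partition_cons stp.
have sx : s <= x by move: stp => [/= /andP[/ltW]].
have xt := itv_partition_le xtp.
have {}ih : `|trapezoid f g x t p - a * (g t - g x)| <= eta * (g t - g x).
  apply: ih => // [u /andP[xu ut]|u v xu]; first by rewrite fa// ut (le_trans sx).
  by apply: gmono; rewrite (le_trans sx).
have := fa s; rewrite lexx (le_trans sx)// => /(_ isT) fs.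
have := fa x; rewrite sx xt => /(_ isT) fx.
have gsx : 0 <= g x - g s by rewrite subr_ge0 gmono.
rewrite trapezoid_cons.
have -> : (f s + f x) / 2 * (g x - g s) + trapezoid f g x t p - a * (g t - g s)
   = ((f s - a) + (f x - a)) / 2 * (g x - g s)
     + (trapezoid f g x t p - a * (g t - g x)) by field.
have -> : eta * (g t - g s) = eta * (g x - g s) + eta * (g t - g x) by ring.
apply: (le_trans (ler_normD _ _)); apply: lerD => //.
rewrite normrM (ger0_norm gsx) ler_wpM2r// normrM [`|2^-1|]ger0_norm ?invr_ge0//.
by rewrite ler_pdivrMr// (le_trans (ler_normD _ _))// mulr_natr mulr2n lerD.
Qed.

Lemma trapezoid_adherent_near_const (R : realType) (f g : R -> R)
    (a eta s t z : R) :
  trapezoid_adherent f g s t z ->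
  (forall u, s <= u <= t -> `|f u - a| <= eta) ->
  (forall u v, s <= u -> u <= v -> v <= t -> g u <= g v) ->
  `|z - a * (g t - g s)| <= eta * (g t - g s).
Proof.
move=> fgz fa gmono; apply/ler_addgt0Pr => e e0.
have [p stp pz] := fgz _ e0.
have Ta := trapezoid_near_const stp fa gmono.
have -> : z - a * (g t - g s) = (trapezoid f g s t p - a * (g t - g s))
    - (trapezoid f g s t p - z) by ring.
by rewrite (le_trans (ler_normB _ _))// lerD.
Qed.

Lemma trapezoid_adherent_eq (R : realType) (f f' g : R -> R) (s t z : R) :
  (forall u, s <= u <= t -> f u = f' u) ->
  trapezoid_adherent f g s t z -> trapezoid_adherent f' g s t z.
Proof.
move=> ff' fgz eps /fgz[p stp pz]; exists p => //.
rewrite -(_ : trapezoid f g s t p = trapezoid f' g s t p)//.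
have in_st n : (n <= size p)%N -> s <= nth t (s :: p) n <= t.
  by move=> np; rewrite itv_partition_nth_ge ?itv_partition_nth_le.
apply: eq_big_nat => n /andP[_ np].
by rewrite !ff' ?in_st// ltnW.
Qed.

(** * Differentiating an indefinite integral known through its sums *)

Lemma rat_of_near (R : realType) (u : R) (A : set R) :
  (\forall x \near u, A x) -> exists q : rat, A (ratr q).
Proof.
rewrite /prop_near1 nbhsE => -[U [oU Uu] UA].
have [|x [Ux [q _ qx]]] := @dense_rat R U _ oU; first by exists u.
by exists q; rewrite qx; exact: UA.
Qed.

(** Almost sure statements hold simultaneously at countably many times only;
    continuity carries them from rational times to all times. *)
Lemma nondecreasing_of_rat (R : realType) (K : R -> R) (a b : R) :
  (forall x, a < x < b -> {for x, continuous K}) ->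
  (forall p q : rat, a < ratr p -> ratr p < ratr q :> R -> ratr q < b ->
     K (ratr p) <= K (ratr q)) ->
  forall s t, a < s -> s <= t -> t < b -> K s <= K t.
Proof.
move=> cK Krat s t as_; rewrite le_eqVlt => /predU1P[->//|st] tb.
rewrite leNgt; apply/negP => Kts.
have [Ks Kt] : {for s, continuous K} /\ {for t, continuous K}.
  by split; apply: cK; rewrite ?as_ ?tb ?andbT ?(lt_trans as_ st)// (lt_trans st).
have mid1 := midf_lt Kts; have mid2 := midf_lt st.
have /rat_of_near[p [pa pm Kp]] :
    \forall x \near s, [/\ a < x, x < (s + t) / 2 & (K t + K s) / 2 < K x].
  near=> x; split; near: x.
  - exact: lt_nbhsr.
  - by apply: lt_nbhsl; apply: mid2.1.
  - by apply: (cvgr_gt _ Ks); apply: mid1.2.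
have /rat_of_near[q [qm qb Kq]] :
    \forall x \near t, [/\ (s + t) / 2 < x, x < b & K x < (K t + K s) / 2].
  near=> x; split; near: x.
  - by apply: lt_nbhsr; apply: mid2.2.
  - exact: lt_nbhsl.
  - by apply: (cvgr_lt _ Kt); apply: mid1.1.
have := Krat p q pa (lt_trans pm qm) qb.
by rewrite leNgt (lt_trans Kq).
Unshelve. all: by end_near.
Qed.

Lemma eq_of_rat (R : realType) (f g : R -> R) (T u : R) :
  {for u, continuous f} -> {for u, continuous g} -> u < T ->
  (forall q : rat, ratr q < T -> f (ratr q) = g (ratr q)) -> f u = g u.
Proof.
move=> cf cg uT fg; apply/eqP; rewrite -subr_eq0; apply/negPn/negP => fgu.
have cfg : f x - g x @[x --> u] --> f u - g u by exact: cvgB.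
have /rat_of_near[q [qT]] : \forall x \near u, x < T /\ f x - g x != 0.
  near=> x; split; near: x; first exact: lt_nbhsl.
  exact: (cvgr_neq0 _ cfg).
by rewrite fg// subrr eqxx.
Unshelve. all: by end_near.
Qed.

Lemma is_derive_cvgP (R : realType) (f : R -> R) (u a : R) :
  is_derive u 1 f a <-> h^-1 * (f (u + h) - f u) @[h --> 0^'] --> a.
Proof.
have E : (fun h => h^-1 *: ((f \o shift u) (h *: (1 : R)) - f u)) =
    (fun h => h^-1 * (f (u + h) - f u)).
  by apply/funext => h /=; rewrite /GRing.scale/= mulr1 [h + u]addrC.
split => [[df <-]|fa]; first by move: df; rewrite /derive /derivable E.
by split; rewrite /derivable /derive E; [exact: cvgP fa|exact: cvg_lim fa].
Qed.

(** Chain rule [dF = phi dpsi].  On a short interval around [u] the function [phi]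
    is within [eps] of [phi u], hence so is every trapezoidal sum from
    [phi u (psi t - psi s)], up to the factor [psi t - psi s]; an adherent value
    inherits the bound. *)
Lemma is_derive_of_adherent (R : realType) (phi psi F : R -> R) (T u dpsi : R) :
  u < T -> {for u, continuous phi} ->
  (forall x, x < T -> {for x, continuous F}) ->
  continuous psi -> {homo psi : x y / x <= y} -> is_derive u 1 psi dpsi ->
  (forall p q : rat, ratr p < ratr q :> R -> ratr q < T ->
     trapezoid_adherent phi psi (ratr p) (ratr q) (F (ratr q) - F (ratr p))) ->
  is_derive u 1 F (phi u * dpsi).
Proof.
move=> uT cphi cF cpsi psi_mono /is_derive_cvgP dpsiE adh.
have incr eps : 0 < eps -> \forall h \near 0,
    `|F (u + h) - F u - phi u * (psi (u + h) - psi u)|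
      <= eps * `|psi (u + h) - psi u|.
  move=> eps0.
  have /nbhs_ballP[d /= d0 dphi] : \forall x \near u,
      x < T /\ `|phi x - phi u| <= eps.
    near=> x; split; near: x; first exact: lt_nbhsl.
    by move/cvgrPdist_le : cphi => /(_ _ eps0); apply: filterS => x; rewrite distrC.
  have {}dphi x : u - d < x < u + d -> x < T /\ `|phi x - phi u| <= eps.
    by move=> xd; apply: dphi; rewrite /ball/= distrC ltr_distl.
  have rat_le p q : u - d < ratr p -> ratr p < ratr q :> R -> ratr q < u + d ->
      `|F (ratr q) - F (ratr p) - phi u * (psi (ratr q) - psi (ratr p))|
        <= eps * (psi (ratr q) - psi (ratr p)).
    move=> pd pq qd; apply: trapezoid_adherent_near_const.
    - apply: adh => //.
      by case: (dphi (ratr q)); rewrite ?qd ?(lt_trans pd).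
    - move=> x /andP[px xq]; case: (dphi x) => //.
      by rewrite (lt_le_trans pd)// (le_lt_trans xq).
    - by move=> x y _ xy _; exact: psi_mono.
  have cdphi x : u - d < x < u + d ->
      {for x, continuous F} /\ {for x, continuous psi}.
    by move=> /dphi[xT _]; split; [exact: cF|exact: cpsi].
  (* The two-sided bound says that [F - (phi u - eps) psi] and
     [(phi u + eps) psi - F] are nondecreasing. *)
  have all_le s t : u - d < s -> s <= t -> t < u + d ->
      `|F t - F s - phi u * (psi t - psi s)| <= eps * (psi t - psi s).
    move=> ds st td.
    have lo : F s - (phi u - eps) * psi s <= F t - (phi u - eps) * psi t.
      apply: (@nondecreasing_of_rat R (fun x => F x - (phi u - eps) * psi x)
        (u - d) (u + d)) => // [x /cdphi[cFx cpsix]|p q pd pq qd].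
        by apply: cvgB => //; apply: cvgM => //; exact: cvg_cst.
      by have := rat_le p q pd pq qd; rewrite ler_norml => /andP[+ _]; lra.
    have hi : (phi u + eps) * psi s - F s <= (phi u + eps) * psi t - F t.
      apply: (@nondecreasing_of_rat R (fun x => (phi u + eps) * psi x - F x)
        (u - d) (u + d)) => // [x /cdphi[cFx cpsix]|p q pd pq qd].
        by apply: cvgB => //; apply: cvgM => //; exact: cvg_cst.
      by have := rat_le p q pd pq qd; rewrite ler_norml => /andP[_]; lra.
    by rewrite ler_norml; apply/andP; split; lra.
  near=> h.
  have hd : `|h| < d by near: h; exact: (@nbhs0_lt R R).
  move: hd; rewrite ltr_norml => /andP[hd1 hd2].
  have [h0|/ltW h0] := leP 0 h.
    rewrite [in leRHS]ger0_norm ?subr_ge0 ?psi_mono ?lerDl//.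
    by apply: all_le; lra.
  rewrite [in leRHS]ler0_norm ?subr_le0 ?psi_mono ?gerDl//.
  have := all_le (u + h) u; rewrite opprB -normrN.
  rewrite (_ : - (_ - _ - _) = F (u + h) - F u - phi u * (psi (u + h) - psi u));
    last by ring.
  by apply; lra.
apply/is_derive_cvgP.
(* The quotients of [F] and of [phi u * psi] differ by at most [eps] times that
   of [psi], which stays bounded. *)
pose Q (f : R -> R) h := h^-1 * (f (u + h) - f u).
have -> : (fun h => h^-1 * (F (u + h) - F u)) =
    (fun h => phi u * Q psi h + (Q F h - phi u * Q psi h)).
  by apply/funext => h; rewrite /Q; ring.
rewrite -[X in _ --> X]addr0; apply: cvgD; first by apply: cvgM => //; exact: cvg_cst.
apply/cvgrPdist_le => /= e e0.
have D0 : 0 < `|dpsi| + 1 by rewrite ltr_wpDl.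
have /incr incr0 : 0 < e / (`|dpsi| + 1) by rewrite divr_gt0.
have {}incr0 := nbhs_dnbhs incr0.
have Qbnd : \forall h \near 0^', `|Q psi h| <= `|dpsi| + 1.
  have := @cvgr_norm_le R R _ _ _ _ _ dpsiE; apply; by rewrite ltrDl.
near=> h.
rewrite sub0r normrN.
have -> : Q F h - phi u * Q psi h =
    h^-1 * (F (u + h) - F u - phi u * (psi (u + h) - psi u)) by rewrite /Q; ring.
rewrite normrM.
apply: (@le_trans _ _ (`|h^-1| * (e / (`|dpsi| + 1) * `|psi (u + h) - psi u|))).
  by apply: ler_wpM2l => //; near: h.
rewrite mulrCA -normrM -/(Q psi h) mulrAC ler_pdivrMr//.
by apply: ler_wpM2l; [exact: ltW|near: h].
Unshelve. all: by end_near.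
Qed.

(** * A function with vanishing exponential moments is zero *)

Lemma continuous_within_lt (R : realType) (f : R -> R) (T u : R) :
  {within `]-oo, T], continuous f} -> u < T -> {for u, continuous f}.
Proof.
move=> /continuous_within_itvNycP[cf _] uT.
by apply: cf; rewrite in_itv.
Qed.

Lemma is_derive_expRM (R : realType) (l u : R) :
  is_derive u 1 (fun x => expR (l * x)) (l * expR (l * u)).
Proof.
have dl : is_derive u 1 (fun x => l * x) l.
  have := @is_deriveM _ _ (fun=> l) id u 1 0 1 _ _.
  by rewrite scaler0 addr0 /GRing.scale/= mulr1; exact.
have := @is_derive1_comp _ expR (fun x => l * x) u _ _ (is_derive_expR _) dl.
by rewrite mulrC.
Qed.

Lemma continuous_expRM (R : realType) (l : R) :
  continuous (fun x => expR (l * x)).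
Proof.
move=> x; apply: (@continuous_comp _ _ _ ( *%R l) expR).
  exact: mulrl_continuous.
exact: continuous_expR.
Qed.

Lemma cvg_expRM_Ny (R : realType) (l : R) :
  0 < l -> expR (l * x) @[x --> -oo] --> 0.
Proof.
move=> l0; apply/cvgrPdist_lt => /= e e0.
exists (ln e / l); split; first exact: num_real.
move=> x; rewrite ltr_pdivlMr// mulrC => lx.
by rewrite sub0r normrN ger0_norm ?expR_ge0// -(lnK e0) ltr_expR.
Qed.

Definition iterated_primitives (R : realType) (T l : R) (h : nat -> R -> R) :=
  [/\ forall k, {within `]-oo, T], continuous (h k)},
      forall k, h k x @[x --> -oo] --> 0
    & forall k u, u < T -> is_derive u 1 (h k.+1) (expR (l * u) * h k u)].

(** Integrating by parts, [exp (l u) h_k q(exp (l u))] has the primitive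
    [h_(k+1) q(exp (l u)) - l Psi], where [Psi] is the same primitive for
    [h_(k+1)] and [q'].  The degree drops, so the recursion ends, and every
    boundary term vanishes at [-oo] and at [T].  Thus all polynomial moments of
    [h_k] with respect to [d exp (l u)] are zero. *)
Lemma iterated_primitives_poly (R : realType) (T l : R) (h : nat -> R -> R)
    (q : {poly R}) (k : nat) :
  0 < l -> iterated_primitives T l h -> (forall k, h k T = 0) ->
  exists Phi : R -> R,
    [/\ {within `]-oo, T], continuous Phi},
        Phi x @[x --> -oo] --> 0,
        Phi T = 0
      & forall u, u < T ->
          is_derive u 1 Phi (expR (l * u) * h k u * q.[expR (l * u)])].
Proof.
move=> l0 [ch h0 dh] hT.
have [n qn] := ubnP (size q).
elim: n => // n ih in q k qn *.
have [->|q0] := eqVneq q 0.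
  exists (fun=> 0); split => //.
  - by move=> x; exact: cvg_cst.
  - exact: cvg_cst.
  - by move=> u _; rewrite horner0 mulr0; exact: is_derive_cst.
have /(ih _ k.+1)[Psi [cPsi Psi0 PsiT dPsi]] : (size q^`() < n)%N.
  by rewrite (leq_trans (lt_size_deriv q0)).
have cq : continuous (fun x : R => q.[expR (l * x)]).
  move=> x; apply: (@continuous_comp _ _ _ (fun x => expR (l * x)) (horner q)).
    exact: continuous_expRM.
  exact: (@continuous_horner R q).
exists (fun x => h k.+1 x * q.[expR (l * x)] - l * Psi x); split.
- move=> x; apply: cvgB; apply: cvgM; [exact: ch| |exact: cvg_cst|exact: cPsi].
  exact: (continuous_subspaceT cq).
- have : h k.+1 x * q.[expR (l * x)] - l * Psi x @[x --> -oo] -->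
      0 * q.[0] - l * 0.
    apply: cvgB; last by apply: cvgM; [exact: cvg_cst|exact: Psi0].
    apply: cvgM; first exact: h0.
    apply: (@cvg_comp _ _ _ (fun x => expR (l * x)) (horner q)).
      exact: (cvg_expRM_Ny l0).
    exact: (@continuous_horner R q).
  by rewrite mul0r mulr0 subrr.
- by rewrite hT PsiT mulr0 mul0r subrr.
- move=> u uT.
  have dq := @is_derive1_comp _ (horner q) (fun x => expR (l * x)) u _ _
    (is_derive_poly _ _) (is_derive_expRM l u).
  have dhq := is_deriveM (dh k u uT) dq.
  have dlP := is_deriveM (@is_derive_cst _ _ R l u 1) (dPsi u uT).
  have := is_deriveB dhq dlP.
  move/is_derive_eq; apply.
  rewrite /GRing.scale/=; ring.
Qed.

Lemma bounded_of_cvg_Ny (R : realType) (f : R -> R) (T : R) :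
  {within `]-oo, T], continuous f} -> f x @[x --> -oo] --> 0 ->
  exists2 B, 0 < B & forall x, x <= T -> `|f x| <= B.
Proof.
move=> cf /cvgrPdist_le/(_ 1 ltr01)[M [_ fM]].
pose N := Num.min (M - 1) T.
have cnf : {within `[N, T], continuous (fun x => `|f x|)}.
  have cf' : {within `[N, T], continuous f}.
    by apply: continuous_subspaceW cf; apply: subset_itv; rewrite bnd_simp.
  by move=> x; apply: cvg_norm; exact: cf'.
have [|c _ cmax] := EVT_max _ cnf; first by rewrite ge_min lexx orbT.
exists (1 + `|f c|); first by rewrite ltr_wpDr.
move=> x xT; have [xM|Mx] := ltP x M.
  by have := fM x xM; rewrite sub0r normrN => /le_trans; apply; rewrite lerDl.
rewrite (@le_trans _ _ `|f c|) ?lerDr// cmax// in_itv/= xT andbT ge_min.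
by rewrite (le_trans _ Mx)// gerBl.
Qed.

Lemma homo_le_of_derive (R : realType) (f df : R -> R) (T : R) :
  {within `]-oo, T], continuous f} ->
  (forall x, x < T -> is_derive x 1 f (df x)) ->
  (forall x, x < T -> 0 <= df x) ->
  forall s t, s <= t -> t <= T -> f s <= f t.
Proof.
move=> cf f_df df0 s t; rewrite le_eqVlt => /predU1P[->//|st] tT.
have [x||c cst E] := @MVT R f df s t st.
- by rewrite in_itv/= => /andP[_ xt]; apply: f_df; exact: lt_le_trans tT.
- by apply: continuous_subspaceW cf; apply: subset_itv; rewrite ?bnd_simp.
rewrite -subr_ge0 E mulr_ge0 ?subr_ge0 ?(ltW st)// df0//.
by move: cst; rewrite in_itv/= => /andP[_ /lt_le_trans]; apply.
Qed.

Lemma const_of_derive0 (R : realType) (f : R -> R) (T : R) :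
  {within `]-oo, T], continuous f} ->
  (forall x, x < T -> is_derive x 1 f 0) ->
  forall s t, s <= t -> t <= T -> f s = f t.
Proof.
move=> cf df s t; rewrite le_eqVlt => /predU1P[->//|st] tT.
have [x||c _ E] := @MVT R f (fun=> 0) s t st.
- by rewrite in_itv/= => /andP[_ xt]; apply: df; exact: lt_le_trans tT.
- by apply: continuous_subspaceW cf; apply: subset_itv; rewrite ?bnd_simp.
by apply/esym/eqP; rewrite -subr_eq0 E mul0r.
Qed.

Lemma ge0_of_cvg_Ny (R : realType) (f : R -> R) (T : R) :
  f x @[x --> -oo] --> 0 ->
  (forall s t, s <= t -> t <= T -> f s <= f t) ->
  forall t, t <= T -> 0 <= f t.
Proof.
move=> f0 fmono t tT; rewrite leNgt; apply/negP => ft0.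
have [x [xt]] : exists x, x <= t /\ f t < f x.
  apply: (@filter_ex _ -oo); near=> x; split; near: x.
    by exists t; split; [exact: num_real|move=> x /ltW].
  exact: (cvgr_gt _ f0).
by rewrite ltNge fmono.
Unshelve. all: by end_near.
Qed.

Lemma bernoulli_ineq (R : realType) (x : R) (n : nat) :
  0 <= x -> 1 + n%:R * x <= (1 + x) ^+ n.
Proof.
move=> x0; elim: n => [|n ih]; first by rewrite mul0r addr0 expr0.
have n0 : 0 <= n%:R * (x * x) by rewrite !mulr_ge0.
have := ler_wpM2l (addr_ge0 ler01 x0) ih; rewrite exprS -natr1; lra.
Qed.

(** If [h 0] were positive at [c], test it against large powers of a polynomial
    [q] which exceeds [1] exactly on a neighbourhood of [c]: there
    [h 0 * q ^+ n] grows without bound, while elsewhere [0 <= q <= 1] and the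
    contribution stays bounded, so the moments cannot all vanish.  Moments are
    handled through their primitives [Phi], and the bound outside the
    neighbourhood becomes the monotonicity of [Phi + B / l * exp (l u)]. *)
Lemma iterated_primitives_le0 (R : realType) (T l : R) (h : nat -> R -> R)
    (c : R) :
  0 < l -> iterated_primitives T l h -> (forall k, h k T = 0) ->
  c < T -> h 0%N c <= 0.
Proof.
move=> l0 ph hT cT; have [ch h0 dh] := ph; rewrite leNgt; apply/negP => hc0.
have chc := continuous_within_lt (ch 0%N) cT.
have /nbhs_ballP[d /= d0 near_c] : \forall x \near c, h 0%N c / 2 <= h 0%N x /\ x < T.
  near=> x; split; near: x; last exact: lt_nbhsl.
  have hc2 : h 0%N c / 2 < h 0%N c by rewrite ltr_pdivrMr// mulr_natr mulr2n ltrDl.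
  by apply: filterS (cvgr_gt _ chc _ hc2) => x /ltW.
pose eps := h 0%N c / 2.
have eps0 : 0 < eps by rewrite divr_gt0.
have {}near_c x : c - d < x < c + d -> eps <= h 0%N x /\ x < T.
  by move=> xd; apply: near_c; rewrite /ball/= distrC ltr_distl.
pose X u : R := expR (l * u).
have X0 u : 0 < X u := expR_gt0 _.
have Xmono u v : u <= v -> X u <= X v by move=> uv; rewrite ler_expR ler_pM2l.
have Xlt u v : u < v -> X u < X v by move=> uv; rewrite ltr_expR ltr_pM2l.
pose a := c - d / 2; pose a' := c - d / 4; pose b' := c + d / 4; pose b := c + d / 2.
have aa' : a < a' by rewrite /a /a'; lra.
have a'b' : a' < b' by rewrite /a' /b'; lra.
have b'b : b' < b by rewrite /b /b'; lra.
have [ad bd] : c - d < a /\ b < c + d by rewrite /a /b; split; lra.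
have bT : b < T by case: (near_c b) => //; apply/andP; split; rewrite // /b; lra.
have XT u : u <= T -> X u <= X T by exact: Xmono.
have [B B0 hB] := bounded_of_cvg_Ny (ch 0%N) (h0 0%N).
(* [q] lies above [1] between [X a] and [X b]; this choice of [kap] keeps it
   nonnegative on the whole of []0, X T]]. *)
pose kap := (X T * X T)^-1.
have kap0 : 0 < kap by rewrite invr_gt0 mulr_gt0.
have kapE : kap * (X T * X T) = 1 by rewrite mulVf// gt_eqF// mulr_gt0.
pose q : {poly R} := 1 + kap *: (('X - (X a)%:P) * ((X b)%:P - 'X)).
have qE x : q.[x] = 1 + kap * ((x - X a) * (X b - x)).
  by rewrite /q hornerD hornerC hornerZ hornerM !hornerE.
have q_ge0 u : u <= T -> 0 <= q.[X u].
  move=> uT; rewrite qE -kapE -mulrDr mulr_ge0 ?(ltW kap0)//.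
  have := XT u uT; have := XT a; have := XT b; have := X0 u; have := X0 a.
  have := X0 b; have := X0 T.
  have aT : a <= T by rewrite ltW// (lt_trans aa')// (lt_trans a'b')// (lt_trans b'b).
  move=> XT0 Xb0 Xa0 Xu0 /(_ (ltW bT)) XbT /(_ aT) XaT XuT.
  nra.
have q_le1 u : ~~ (a <= u <= b) -> q.[X u] <= 1.
  rewrite negb_and -!ltNge qE gerDl pmulr_rle0// => /orP[ua|bu].
    rewrite mulr_le0_ge0 ?subr_le0 ?subr_ge0 ?Xmono// ltW// (lt_trans ua)//.
    by rewrite (lt_trans aa')// (lt_trans a'b').
  rewrite mulr_ge0_le0 ?subr_le0 ?subr_ge0 ?Xmono// ltW// (lt_trans _ bu)//.
  by rewrite (lt_trans aa')// (lt_trans a'b').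
pose th := kap * ((X a' - X a) * (X b - X b')).
have th0 : 0 < th by rewrite !mulr_gt0// subr_gt0 Xlt.
have q_big u : a' <= u <= b' -> 1 + th <= q.[X u].
  move=> /andP[au ub]; rewrite qE lerD2l ler_pM2l//.
  by apply: ler_pM; rewrite ?subr_ge0 ?Xmono ?(ltW aa') ?(ltW b'b)// lerB// Xmono.
(* [Phi] loses at most [B / l * X T] before [a'] and again after [b']. *)
pose C := 2 * (B / l * X T).
pose m := X a' * eps * (b' - a').
have m0 : 0 < m by rewrite !mulr_gt0// subr_gt0.
have gain n : m * (1 + th) ^+ n <= C.
  have [Phi [cPhi Phi0 PhiT dPhi]] := iterated_primitives_poly (q ^+ n) 0 l0 ph hT.
  pose Psi u := Phi u + B / l * X u.
  have cPsi : {within `]-oo, T], continuous Psi}.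
    move=> x; apply: cvgD; first exact: cPhi.
    by apply: cvgM; [exact: cvg_cst|exact/continuous_subspaceT/continuous_expRM].
  have Psi0 : Psi x @[x --> -oo] --> 0.
    have : Psi x @[x --> -oo] --> 0 + B / l * 0.
      apply: cvgD => //; apply: cvgM; [exact: cvg_cst|exact: (cvg_expRM_Ny l0)].
    by rewrite mulr0 addr0.
  have Psi_mono s t : s <= t -> t <= T -> Psi s <= Psi t.
    apply: (@homo_le_of_derive _ Psi
      (fun u => X u * (h 0%N u * (q ^+ n).[X u] + B))) => // u uT.
      have dlX := is_deriveM (@is_derive_cst _ _ R (B / l) u 1) (is_derive_expRM l u).
      have := is_deriveD (dPhi u uT) dlX.
      move/is_derive_eq; apply.
      rewrite /GRing.scale/= mulr0 addr0 -/(X u); field.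
      by rewrite gt_eqF.
    rewrite mulr_ge0 ?(ltW (X0 u))// horner_exp.
    have := hB u (ltW uT); rewrite ler_norml => /andP[hB1 hB2].
    have qn0 : 0 <= q.[X u] ^+ n by rewrite exprn_ge0// q_ge0// ltW.
    have [hu0|hu0] := leP 0 (h 0%N u); first by have := mulr_ge0 hu0 qn0; lra.
    have qn1 : q.[X u] ^+ n <= 1.
      apply: exprn_ile1; first exact: q_ge0 (ltW uT).
      apply: q_le1; apply/negP => /andP[au ub].
      have [] := near_c u; last by move=> /(lt_le_trans eps0)/ltW; rewrite leNgt hu0.
      by rewrite (lt_le_trans ad)// (le_lt_trans ub).
    have := ler_wnM2l (ltW hu0) qn1; lra.
  have a'T : a' <= T by rewrite ltW// (lt_trans a'b')// (lt_trans b'b).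
  have b'T : b' <= T by rewrite ltW// (lt_trans b'b).
  have Pa := ge0_of_cvg_Ny Psi0 Psi_mono a'T.
  have Pb := Psi_mono b' T b'T (lexx _).
  have [x||e eab E] := @MVT R Phi
    (fun u => X u * h 0%N u * (q ^+ n).[X u]) a' b' a'b'.
  - rewrite in_itv/= => /andP[_ xb]; apply: dPhi; exact: lt_le_trans b'T.
  - by apply: continuous_subspaceW cPhi; apply: subset_itv; rewrite ?bnd_simp.
  have {eab}[ea eb] : a' <= e /\ e <= b'.
    by move: eab; rewrite in_itv/= => /andP[/ltW ? /ltW].
  have : m * (1 + th) ^+ n <= Phi b' - Phi a'.
    rewrite E /m mulrAC ler_wpM2r ?subr_ge0 ?(ltW a'b')//.
    have eps_h : eps <= h 0%N e.
      have [] := near_c e => //.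
      by rewrite (lt_le_trans (lt_trans ad aa'))// (le_lt_trans eb)// (lt_trans b'b).
    have th1 : 0 <= 1 + th by rewrite addr_ge0// ltW.
    have qe : 1 + th <= q.[X e] by rewrite q_big// ea.
    apply: ler_pM.
    - by rewrite mulr_ge0// ltW.
    - exact: exprn_ge0.
    - by apply: ler_pM => //; [exact: ltW|exact: ltW|exact: Xmono].
    - by rewrite horner_exp lerXn2r ?nnegrE// (le_trans th1).
  move: Pa Pb; rewrite /Psi PhiT add0r /C.
  have Bl : 0 < B / l by rewrite divr_gt0.
  have := ler_wpM2l (ltW Bl) (XT _ a'T).
  have := mulr_gt0 Bl (X0 b'); lra.
have [n Cn] : exists n : nat, C / (m * th) < n%:R.
  exists (Num.bound (C / (m * th))); apply: archi_boundP.
  apply: divr_ge0; last exact/ltW/mulr_gt0.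
  exact/ltW/mulr_gt0/mulr_gt0/X0/divr_gt0.
have := le_trans (ler_wpM2l (ltW m0) (bernoulli_ineq n (ltW th0))) (gain n).
rewrite leNgt => /negP; apply.
move: Cn; rewrite ltr_pdivrMr ?(mulr_gt0 m0 th0)// mulrDr mulr1 mulrCA => Cn.
by rewrite (lt_trans Cn)// ltrDr.
Unshelve. all: by end_near.
Qed.

Lemma iterated_primitives_eq0 (R : realType) (T l : R) (h : nat -> R -> R) :
  0 < l -> iterated_primitives T l h -> (forall k, h k T = 0) ->
  forall u, u <= T -> h 0%N u = 0.
Proof.
move=> l0 ph hT u; rewrite le_eqVlt => /predU1P[->//|uT].
apply/eqP; rewrite eq_le (iterated_primitives_le0 l0 ph)//=.
have phN : iterated_primitives T l (fun k x => - h k x).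
  have [ch h0 dh] := ph; split.
  - by move=> k x; apply: cvgN; exact: ch.
  - by move=> k; rewrite -[0]oppr0; apply: cvgN; exact: h0.
  - by move=> k v vT; rewrite mulrN; apply: is_deriveN; exact: dh.
rewrite -oppr_le0 (iterated_primitives_le0 l0 phN)// => k.
by rewrite hT oppr0.
Qed.

(** * Recovering a path from its tower of fading integrals *)

(** The recursion satisfied by the rescaled components of the words
    [i 0 ... 0] along one sample path [x] of the component [i]: a differential
    equation in integrated form, known at rational times only. *)
Definition fading_tower (R : realType) (T l l0 : R) (x : R -> R)
    (g : nat -> R -> R) : Prop :=
  [/\ forall k, {within `]-oo, T], continuous (g k)},
      forall k, g k u @[u --> -oo] --> 0,
      forall p q : rat, ratr p < ratr q :> R -> ratr q < T ->
        trapezoid_adherent (fun u => expR (l * u)) x (ratr p) (ratr q)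
          (g 0%N (ratr q) - g 0%N (ratr p))
    & forall k (p q : rat), ratr p < ratr q :> R -> ratr q < T ->
        trapezoid_adherent (fun u => expR (l0 * u) * g k u) id
          (ratr p) (ratr q) (g k.+1 (ratr q) - g k.+1 (ratr p))].

Lemma fading_tower_derive (R : realType) (T l l0 : R) (x : R -> R)
    (g : nat -> R -> R) (k : nat) (u : R) :
  fading_tower T l l0 x g -> u < T ->
  is_derive u 1 (g k.+1) (expR (l0 * u) * g k u).
Proof.
move=> [cg _ _ adh] uT; rewrite -[X in is_derive _ _ _ X]mulr1.
apply: (@is_derive_of_adherent _ (fun u => expR (l0 * u) * g k u) id
  (g k.+1) T u 1 uT) => //.
- by apply: cvgM; [exact: continuous_expRM|exact: continuous_within_lt (cg k) uT].
- by move=> v vT; exact: continuous_within_lt vT.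
- by move=> v; exact: cvg_id.
- exact: (adh k).
Qed.

(** The path [x] is merely continuous, hence no integrator for a pathwise
    integral; summation by parts makes [exp (l u)] the integrator instead. *)
Lemma fading_tower_derive0 (R : realType) (T l l0 : R) (x : R -> R)
    (g : nat -> R -> R) (u : R) :
  0 < l -> fading_tower T l l0 x g -> {within `]-oo, T], continuous x} ->
  u < T ->
  is_derive u 1 (fun v => expR (l * v) * x v - g 0%N v)
    (x u * (l * expR (l * u))).
Proof.
move=> l0p [cg _ adh _] cx uT.
apply: (@is_derive_of_adherent _ x (fun v => expR (l * v)) _ T u _ uT).
- exact: continuous_within_lt cx uT.
- move=> v vT; apply: cvgB; last exact: continuous_within_lt (cg 0%N) vT.
  by apply: cvgM; [exact: continuous_expRM|exact: continuous_within_lt cx vT].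
- exact: continuous_expRM.
- by move=> v w vw; rewrite ler_expR ler_pM2l.
- exact: is_derive_expRM.
- move=> p q pq qT.
  have := trapezoid_adherent_by_parts (adh p q pq qT).
  by congr trapezoid_adherent; ring.
Qed.

(** Once [g 0 = g' 0], the functions differentiated in [fading_tower_derive0]
    have the difference [E = exp (l u) (x - y)], and [E' = l E]. *)
Lemma path_determined (R : realType) (T l l0 : R) (x y : R -> R)
    (g g' : nat -> R -> R) :
  0 < l -> 0 < l0 ->
  {within `]-oo, T], continuous x} -> {within `]-oo, T], continuous y} ->
  fading_tower T l l0 x g -> fading_tower T l l0 y g' ->
  (forall k, g k T = g' k T) ->
  forall t, t <= T -> x t - y t = x T - y T.
Proof.
move=> lp l0p cx cy tg tg' gT.
have [cg g0 _ _] := tg; have [cg' g'0 _ _] := tg'.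
pose h k u := g k u - g' k u.
have ph : iterated_primitives T l0 h.
  split.
  - by move=> k u; apply: cvgB; [exact: cg|exact: cg'].
  - by move=> k; rewrite -[0]subr0; apply: cvgB; [exact: g0|exact: g'0].
  - move=> k u uT; rewrite /h mulrBr.
    by apply: is_deriveB; [exact: fading_tower_derive tg uT|
      exact: fading_tower_derive tg' uT].
have gg' : forall u, u <= T -> g 0%N u = g' 0%N u.
  move=> u uT; apply/eqP; rewrite -subr_eq0; apply/eqP.
  by apply: (iterated_primitives_eq0 l0p ph) => // k; rewrite /h gT subrr.
pose E u := expR (l * u) * x u - g 0%N u - (expR (l * u) * y u - g' 0%N u).
pose W u := expR (- l * u) * E u.
have ee u : expR (- l * u) * expR (l * u) = 1.
  by rewrite -expRD mulNr addNr expR0.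
have WE u : u <= T -> W u = x u - y u.
  move=> uT; rewrite /W /E gg'// -[RHS]mul1r -(ee u); ring.
have dW u : u < T -> is_derive u 1 W 0.
  move=> uT.
  have dE : is_derive u 1 E
      (x u * (l * expR (l * u)) - y u * (l * expR (l * u))).
    exact: is_deriveB (fading_tower_derive0 lp tg cx uT)
    (fading_tower_derive0 lp tg' cy uT).
  have := is_deriveM (is_derive_expRM (- l) u) dE.
  move/is_derive_eq; apply.
  rewrite /GRing.scale/= /E (gg' _ (ltW uT)); ring.
have cW : {within `]-oo, T], continuous W}.
  have ce (c : R) : {within `]-oo, T], continuous (fun u => expR (c * u))}.
    exact/continuous_subspaceT/continuous_expRM.
  move=> u; apply: cvgM; first exact: ce.
  by apply: cvgB; apply: cvgB;
    [apply: cvgM; [exact: ce|exact: cx]|exact: cg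
    |apply: cvgM; [exact: ce|exact: cy]|exact: cg'].
move=> t tT; rewrite -(WE t tT) -(WE T (lexx _)).
exact: const_of_derive0 cW dW _ _ tT (lexx _).
Qed.

(** * Limits in probability along partitions *)

Lemma ae_forall_countable (R : realType) (disp : measure_display)
    (Omega : measurableType disp) (P : probability Omega R) (I : countType)
    (A : I -> Omega -> Prop) :
  (forall i, {ae P, forall w, A i w}) -> {ae P, forall w, forall i, A i w}.
Proof.
move=> Ai.
have H (n : nat) : {ae P, forall w, if unpickle n is Some i then A i w else True}.
  by case: (unpickle n) => [i|]; [exact: Ai|exact: aeW].
apply: filterS (ae_foralln H) => w Hw i.
by have := Hw (pickle i); rewrite pickleK.
Qed.

Lemma exists_fine_partition (R : realType) (s t delta : R) :
  s <= t -> 0 < delta ->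
  exists2 p, itv_partition s t p & mesh_lt s t p delta.
Proof.
move=> st d0.
have [n tn] : exists n : nat, t - s < n%:R * (delta / 2).
  exists (Num.bound ((t - s) / (delta / 2))).
  rewrite -ltr_pdivrMr ?divr_gt0//; apply: archi_boundP.
  by rewrite divr_ge0 ?subr_ge0 ?divr_ge0// ltW.
elim: n s st tn => [s|n ih s]; first by rewrite mul0r subr_lt0 leNgt => /negbTE->.
rewrite le_eqVlt => /predU1P[<- _|st]; first by exists [::] => //; split.
have [sd _|sd tn] := ltP t (s + delta / 2).
  exists [:: t]; first exact: itv_partition1.
  by move=> [|//] _ /=; lra.
have [||p [xp pt] xtp] := ih (s + delta / 2) => //.
  by move: tn; rewrite -natr1; lra.
exists (s + delta / 2 :: p).
  by split=> //=; rewrite xp andbT; lra.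
move=> [_ /=|k kp]; first by lra.
exact: (xtp k).
Qed.

Lemma mesh_ltW (R : realType) (s t d d' : R) (p : seq R) :
  d <= d' -> mesh_lt s t p d -> mesh_lt s t p d'.
Proof. by move=> dd' pd n np; rewrite (lt_le_trans _ dd')// pd. Qed.

Section limits_in_probability.
Context (R : realType) (disp : measure_display) (Omega : measurableType disp)
        (P : probability Omega R).

Lemma measurable_deviation (f g : Omega -> R) (eps : R) :
  measurable_fun setT f -> measurable_fun setT g ->
  measurable [set w | eps < `|f w - g w|].
Proof.
move=> mf mg.
have : measurable_fun setT (fun w => `|f w - g w|).
  by apply: measurableT_comp => //; exact: measurable_funB.
move/(_ measurableT `]eps, +oo[%classic (measurable_itv _)).
rewrite setTI; congr measurable; apply/seteqP; split => w /=;
  by rewrite in_itv/= andbT.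
Qed.

(** For every [k], partitions can be chosen along which the probability of a
    deviation above [1 / k.+1] tends to zero; the event that all of them deviate
    is then null. *)
Lemma cvg_in_probability_adherent (s t : R) (S : seq R -> Omega -> R)
    (Z : Omega -> R) :
  s <= t -> (forall p, measurable_fun setT (S p)) -> measurable_fun setT Z ->
  partition_cvg_in_probability P s t S Z ->
  {ae P, forall w, forall eps : R, 0 < eps ->
    exists2 p, itv_partition s t p & `|S p w - Z w| <= eps}.
Proof.
move=> st mS mZ SZ.
have step (k : nat) : {ae P, forall w,
    exists2 p, itv_partition s t p & `|S p w - Z w| <= k.+1%:R^-1}.
  have /choice[p pP] (n : nat) : exists p : seq R, itv_partition s t p /\
      (P [set w | (k.+1%:R^-1 < `|S p w - Z w|)%R] < (n.+1%:R^-1)%:E)%E.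
    have [delta d0 H] : exists2 delta : R, 0 < delta &
        forall p, itv_partition s t p -> mesh_lt s t p delta ->
        (P [set w | (k.+1%:R^-1 < `|S p w - Z w|)%R] < (n.+1%:R^-1)%:E)%E.
      by apply: SZ; rewrite invr_gt0.
    have [p stp ptd] := exists_fine_partition st d0.
    by exists p; split => //; exact: H.
  pose N := \bigcap_n [set w | (k.+1%:R^-1 < `|S (p n) w - Z w|)%R].
  have mN : measurable N.
    by apply: bigcapT_measurable => n; exact: measurable_deviation.
  exists N; split => //.
  - apply/eqP; rewrite -measure_le0; apply/lee_addgt0Pr => e e0.
    rewrite add0e.
    pose n := Num.bound e^-1.
    apply: (@le_trans _ _ (P [set w | (k.+1%:R^-1 < `|S (p n) w - Z w|)%R])).
      apply: le_measure; rewrite ?inE//; first exact: measurable_deviation.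
      by move=> w /(_ n); exact.
    apply/ltW/(lt_le_trans (pP n).2); rewrite lee_fin.
    rewrite invf_ple ?posrE// (le_trans (ltW (archi_boundP _)))//.
      by rewrite invr_ge0 ltW.
    by rewrite ler_nat.
  - move=> w /= Nw n _ /=; rewrite ltNge; apply/negP => Sn.
    by apply: Nw; exists (p n) => //; exact: (pP n).1.
apply: filterS (ae_foralln step) => w Sw eps eps0.
have [p stp Sp] := Sw (Num.bound eps^-1).
exists p => //; rewrite (le_trans Sp)// invf_ple ?posrE//.
rewrite (le_trans (ltW (archi_boundP _))) ?ler_nat//.
by rewrite invr_ge0 ltW.
Qed.

Lemma cvg_in_probabilityD (s t c : R) (S S' : seq R -> Omega -> R)
    (Z Z' : Omega -> R) :
  (forall p, measurable_fun setT (S p)) ->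
  (forall p, measurable_fun setT (S' p)) ->
  measurable_fun setT Z -> measurable_fun setT Z' ->
  partition_cvg_in_probability P s t S Z ->
  partition_cvg_in_probability P s t S' Z' ->
  partition_cvg_in_probability P s t (fun p w => S p w + c * S' p w)
    (fun w => Z w + c * Z' w).
Proof.
move=> mS mS' mZ mZ' SZ SZ' eps eta eps0 eta0.
have c0 : 0 < `|c| + 1 by rewrite ltr_wpDl.
(* [|c| + 1] rather than [|c|], since [c] may be zero. *)
pose e2 := eps / 2 / (`|c| + 1).
have [||d d0 Hd] := SZ (eps / 2) (eta / 2); [exact: divr_gt0..|].
have [||d' d'0 Hd'] := SZ' e2 (eta / 2); [by rewrite !divr_gt0|exact: divr_gt0|].
exists (Num.min d d'); first by rewrite lt_min d0.
move=> p stp pd.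
have [dd dd'] : Num.min d d' <= d /\ Num.min d d' <= d'.
  by rewrite !ge_min !lexx orbT.
have {}Hd := Hd p stp (mesh_ltW dd pd).
have {}Hd' := Hd' p stp (mesh_ltW dd' pd).
set A := [set w | _] in Hd; set B := [set w | _] in Hd'.
have mA : measurable A by exact: measurable_deviation.
have mB : measurable B by exact: measurable_deviation.
apply: (@le_lt_trans _ _ (P (A `|` B))).
  apply: le_measure; rewrite ?inE.
  - apply: measurable_deviation; apply: measurable_funD => //;
    by apply: measurable_funM.
  - exact: measurableU.
  move=> w /=; apply: contraPP; rewrite not_orP /A /B /=.
  move=> [/negP + /negP]; rewrite -!leNgt => Aw Bw; apply/negP; rewrite -leNgt.
  have -> : S p w + c * S' p w - (Z w + c * Z' w) =
    (S p w - Z w) + c * (S' p w - Z' w) by ring.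
  rewrite (le_trans (ler_normD _ _))// [leRHS](splitr eps) lerD// normrM.
  rewrite (@le_trans _ _ ((`|c| + 1) * e2))//.
    by apply: ler_pM => //; rewrite lerDl.
  by rewrite /e2 mulrC divfK// gt_eqF.
apply: (le_lt_trans (measureU2 _ mA mB)).
by rewrite [eta]splitr EFinD; apply: lteD.
Qed.

End limits_in_probability.

(** * Stratonovich integrals *)

Lemma measurable_left_sum (R : realType) (disp : measure_display)
    (Omega : measurableType disp) (H X : R -> Omega -> R) (s t : R)
    (p : seq R) :
  (forall u, measurable_fun setT (H u)) ->
  (forall u, measurable_fun setT (X u)) ->
  measurable_fun setT (left_sum H X s t p).
Proof.
move=> mH mX; apply: measurable_sum => n.
by apply: measurable_funM => //; exact: measurable_funB.
Qed.

Lemma measurable_covariation_sum (R : realType) (disp : measure_display)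
    (Omega : measurableType disp) (H X : R -> Omega -> R) (s t : R)
    (p : seq R) :
  (forall u, measurable_fun setT (H u)) ->
  (forall u, measurable_fun setT (X u)) ->
  measurable_fun setT (covariation_sum H X s t p).
Proof.
move=> mH mX; apply: measurable_sum => n.
by apply: measurable_funM; exact: measurable_funB.
Qed.

Lemma trapezoid_left_covariation (R : realType) (Omega : Type)
    (H X : R -> Omega -> R) (s t : R) (p : seq R) (w : Omega) :
  left_sum H X s t p w + 2^-1 * covariation_sum H X s t p w =
  trapezoid (H^~ w) (X^~ w) s t p.
Proof.
rewrite /left_sum /covariation_sum /trapezoid mulr_sumr -big_split /=.
by apply: eq_bigr => n _; field.
Qed.

Section stratonovich.
Context (R : realType) (disp : measure_display) (Omega : measurableType disp)
        (P : probability Omega R).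
Implicit Types (H X : R -> Omega -> R) (Z : Omega -> R).

Lemma stratonovich_cvg_trapezoid H X (s t : R) Z :
  (forall u, measurable_fun setT (H u)) ->
  (forall u, measurable_fun setT (X u)) ->
  stratonovich_integral P H X s t Z ->
  exists Z' : Omega -> R,
    [/\ measurable_fun setT Z',
        forall p, measurable_fun setT
          (fun w => trapezoid (H^~ w) (X^~ w) s t p),
        partition_cvg_in_probability P s t
          (fun p w => trapezoid (H^~ w) (X^~ w) s t p) Z'
      & {ae P, forall w, Z w = Z' w}].
Proof.
move=> mH mX [I [C [itoI covC ZE]]].
have mL p := measurable_left_sum s t p mH mX.
have mC p := measurable_covariation_sum s t p mH mX.
have mI : measurable_fun setT I by exact: measurable_funPT.
have mC' : measurable_fun setT C by exact: measurable_funPT.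
have TE : (fun p w => left_sum H X s t p w + 2^-1 * covariation_sum H X s t p w)
    = (fun p w => trapezoid (H^~ w) (X^~ w) s t p).
  by apply/funext => p; apply/funext => w; exact: trapezoid_left_covariation.
exists (fun w => I w + 2^-1 * C w); split.
- by apply: measurable_funD => //; apply: measurable_funM.
- move=> p; rewrite -[X in measurable_fun _ X]/((fun p w => _) p) -TE.
  by apply: measurable_funD => //; apply: measurable_funM.
- by rewrite -TE; exact: cvg_in_probabilityD.
- by apply: filterS ZE => w ->; rewrite mulrC.
Qed.

Lemma stratonovich_adherent H X (s t : R) Z :
  s <= t ->
  (forall u, measurable_fun setT (H u)) ->
  (forall u, measurable_fun setT (X u)) ->
  stratonovich_integral P H X s t Z ->
  {ae P, forall w, trapezoid_adherent (H^~ w) (X^~ w) s t (Z w)}.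
Proof.
move=> st mH mX /stratonovich_cvg_trapezoid[]// Z' [mZ' mT TZ' ZZ'].
have := cvg_in_probability_adherent st mT mZ' TZ'.
by apply: filterS2 ZZ' => w ->.
Qed.

(** Uniqueness of limits in probability, in the form which compares the fading
    integrals up to two different times: their integrands are proportional. *)
Lemma stratonovich_scale_unique H H' X (s t c : R) Z Z' :
  s <= t ->
  (forall u, measurable_fun setT (H u)) ->
  (forall u, measurable_fun setT (H' u)) ->
  (forall u, measurable_fun setT (X u)) ->
  (forall u w, H' u w = c * H u w) ->
  stratonovich_integral P H X s t Z ->
  stratonovich_integral P H' X s t Z' ->
  {ae P, forall w, Z' w = c * Z w}.
Proof.
move=> st mH mH' mX HH'.
move=> /stratonovich_cvg_trapezoid[]// W [mW mT TW ZW].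
move=> /stratonovich_cvg_trapezoid[]// W' [mW' mT' TW' ZW'].
have TD := cvg_in_probabilityD (- c) mT' mT mW' mW TW' TW.
have mTD p : measurable_fun setT (fun w => trapezoid (H'^~ w) (X^~ w) s t p +
    - c * trapezoid (H^~ w) (X^~ w) s t p).
  by apply: measurable_funD => //; apply: measurable_funM.
have mWD : measurable_fun setT (fun w => W' w + - c * W w).
  by apply: measurable_funD => //; apply: measurable_funM.
have adh := cvg_in_probability_adherent st mTD mWD TD.
apply: filterS3 ZW ZW' adh => w -> -> adh.
apply/eqP; rewrite -subr_eq0 -normr_le0; apply/ler_addgt0Pr => e /adh[p _].
rewrite (@trapezoid_scale _ c (H^~ w) (H'^~ w))// add0r -normrN.
by congr (`|_| <= _); ring.
Qed.

End stratonovich.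

(** * The rescaled signature *)

Lemma cvg_subn_Ny (R : realType) (s : R) : s - n%:R @[n --> \oo] --> -oo.
Proof.
move=> A [M [_ MA]]; exists (Num.bound `|s - M|) => // n /= Nn; apply: MA.
rewrite ltrBlDr addrC -ltrBlDr (le_lt_trans (ler_norm _))//.
by rewrite (lt_le_trans (archi_boundP _))// ler_nat.
Qed.

Section signature.
Context (R : realType) (disp : measure_display) (Omega : measurableType disp)
        (P : probability Omega R) (T : R) (d : nat) (lam : 'I_d.+1 -> R)
        (Xhat : 'I_d.+1 -> R -> Omega -> R)
        (S : seq 'I_d.+1 -> R -> {RV P >-> R})
        (mX : forall j u, measurable_fun setT (Xhat j u))
        (sigS : efm_signature T lam Xhat S).

(** The factor [exp (lambda t)] removes from the fading kernel its dependence on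
    the upper endpoint, so that the increments become integrals over a bounded
    interval. *)
Definition rescaled (v : seq 'I_d.+1) (t : R) (w : Omega) : R :=
  expR (lam_word lam v * t) * S v t w.

Lemma continuous_rescaled (v : seq 'I_d.+1) :
  {ae P, forall w, {within `]-oo, T], continuous (fun t => rescaled v t w)}}.
Proof.
have [_ cS _] := sigS; apply: filterS (cS v) => w cSw u.
apply: cvgM; last exact: cSw.
exact/continuous_subspaceT/continuous_expRM.
Qed.

Let integrand v i t u w :=
  expR (- (lam_word lam (rcons v i) * (t - u))) * S v u w.

Let measurable_integrand v i t u : measurable_fun setT (integrand v i t u).
Proof.
by apply: measurable_funM; [exact: measurable_cst|exact: measurable_funPT].
Qed.

Let integrandE v i s t u w : integrand v i s u w =
  expR (lam_word lam (rcons v i) * (t - s)) * integrand v i t u w.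
Proof. by rewrite /integrand mulrA -expRD; congr (expR _ * _); ring. Qed.

Let integrand_rescaled v i t u w :
  expR (lam_word lam (rcons v i) * u) * S v u w =
  expR (lam_word lam (rcons v i) * t) * integrand v i t u w.
Proof. by rewrite /integrand mulrA -expRD; congr (expR _ * _); ring. Qed.

(** The components at the times [s] and [t] come with unrelated indefinite
    integrals [J'] and [J].  Over bounded intervals these integrate proportional
    integrands, hence agree up to the factor [exp (lambda (t - s))]; letting the
    lower endpoint tend to [-oo] along the integers makes one null set enough. *)
Lemma rescaled_increment_antiderivative (v : seq 'I_d.+1) (i : 'I_d.+1)
    (t : R) (J : R -> {RV P >-> R}) :
  t <= T ->
  (forall r u, r <= u -> u <= t ->
     stratonovich_integral P (integrand v i t) (Xhat i) r u
       (fun w => J u w - J r w)) ->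
  {ae P, forall w, (fun s => J t w - J s w) @ -oo --> S (rcons v i) t w} ->
  forall s, s <= t ->
  {ae P, forall w, rescaled (rcons v i) t w - rescaled (rcons v i) s w =
    expR (lam_word lam (rcons v i) * t) * (J t w - J s w)}.
Proof.
move=> tT stratJ limJ s st; have [_ _ improper] := sigS.
have [J' [_ stratJ' limJ']] := improper v i s (le_trans st tT).
set l := lam_word lam (rcons v i).
pose c := expR (l * (t - s)).
have JJ' : {ae P, forall w, forall n : nat,
    J' s w - J' (s - n%:R) w = c * (J s w - J (s - n%:R) w)}.
  apply: ae_foralln => n.
  have sn : s - n%:R <= s by rewrite gerBl.
  apply: (@stratonovich_scale_unique _ _ _ _ (integrand v i t)
    (integrand v i s) (Xhat i) (s - n%:R) s c _ _ sn) => //.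
  - by move=> u w; exact: integrandE.
  - exact: stratJ.
  - exact: stratJ'.
apply: filterS3 limJ limJ' JJ' => w limJ limJ' JJ'.
have lim1 : J' s w - J' (s - n%:R) w @[n --> \oo] --> S (rcons v i) s w.
  exact: (cvg_comp _ _ (@cvg_subn_Ny R s) limJ').
have lim2 : J' s w - J' (s - n%:R) w @[n --> \oo] -->
    c * (S (rcons v i) t w - (J t w - J s w)).
  have -> : (fun n : nat => J' s w - J' (s - n%:R) w) =
      (fun n => c * ((J t w - J (s - n%:R) w) - (J t w - J s w))).
    by apply/funext => n; rewrite JJ'; ring.
  apply: cvgM; first exact: cvg_cst.
  apply: cvgB; last exact: cvg_cst.
  exact: (cvg_comp _ _ (@cvg_subn_Ny R s) limJ).
have {lim1 lim2}SE := cvg_unique (@Rhausdorff R) lim1 lim2.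
rewrite /rescaled -/l SE mulrA -expRD.
by rewrite (_ : l * s + l * (t - s) = l * t); ring.
Qed.

Lemma rescaled_increment_adherent (v : seq 'I_d.+1) (i : 'I_d.+1) (s t : R) :
  s <= t -> t <= T ->
  {ae P, forall w, trapezoid_adherent
    (fun u => expR (lam_word lam (rcons v i) * u) * S v u w)
    (fun u => Xhat i u w) s t
    (rescaled (rcons v i) t w - rescaled (rcons v i) s w)}.
Proof.
move=> st tT; have [_ _ improper] := sigS.
have [J [_ stratJ limJ]] := improper v i t tT.
have JE := rescaled_increment_antiderivative tT stratJ limJ st.
have := stratonovich_adherent st (measurable_integrand v i t) (mX i)
  (stratJ s t st (lexx t)).
apply: filterS2 JE => w -> adh.
apply: trapezoid_adherent_scale adh; first exact: expR_gt0.
by move=> u; exact: integrand_rescaled.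
Qed.

(** By the increments up to [T], the rescaled component at [s] is, up to a constant
    factor, the tail at [s] of a convergent improper integral. *)
Lemma rescaled_cvg_Ny (v : seq 'I_d.+1) (i : 'I_d.+1) :
  {ae P, forall w, rescaled (rcons v i) s w @[s --> -oo] --> 0}.
Proof.
have [_ _ improper] := sigS.
have [J [cJ stratJ limJ]] := improper v i T (lexx T).
have JE : {ae P, forall w, forall q : rat, ratr q < T ->
    rescaled (rcons v i) (ratr q) w = rescaled (rcons v i) T w -
    expR (lam_word lam (rcons v i) * T) * (J T w - J (ratr q) w)}.
  apply: ae_forall_countable => q.
  have [qT|Tq] := ltP (ratr q) T; last by apply: aeW.
  have := rescaled_increment_antiderivative (lexx T) stratJ limJ (ltW qT).
  by apply: filterS => w <- _; ring.
apply: filterS3 limJ cJ (filterI JE (continuous_rescaled (rcons v i))).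
move=> w {}limJ {}cJ [{}JE cg].
have JEs s : s < T -> rescaled (rcons v i) s w = rescaled (rcons v i) T w -
    expR (lam_word lam (rcons v i) * T) * (J T w - J s w).
  move=> sT; apply: (@eq_of_rat _ (fun s => rescaled (rcons v i) s w)
    (fun s => rescaled (rcons v i) T w -
    expR (lam_word lam (rcons v i) * T) * (J T w - J s w)) T s) => //.
    exact: continuous_within_lt cg sT.
  apply: cvgB; first exact: cvg_cst.
  apply: cvgM; first exact: cvg_cst.
  by apply: cvgB; [exact: cvg_cst|exact: continuous_within_lt cJ sT].
have : rescaled (rcons v i) T w -
    expR (lam_word lam (rcons v i) * T) * (J T w - J s w) @[s --> -oo] --> 0.
  rewrite -[0](subrr (rescaled (rcons v i) T w)) {2}/rescaled.
  apply: cvgB; first exact: cvg_cst.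
  by apply: cvgM; [exact: cvg_cst|exact: limJ].
apply: cvg_trans; apply: near_eq_cvg; near=> s; apply/esym/JEs.
by near: s; exists T; split; [exact: num_real|].
Unshelve. all: by end_near.
Qed.

End signature.

Definition time_word (d : nat) (i : 'I_d) (k : nat) : seq 'I_d.+1 :=
  iter k (fun v => rcons v ord0) [:: lift ord0 i].

Lemma measurable_time_augmented (R : realType) (disp : measure_display)
    (Omega : measurableType disp) (P : probability Omega R) (d : nat)
    (X : 'I_d -> R -> {RV P >-> R}) (j : 'I_d.+1) (u : R) :
  measurable_fun setT (time_augmented X j u).
Proof.
rewrite /time_augmented; case: (unlift ord0 j) => [i|].
  exact: measurable_funPT.
exact: measurable_cst.
Qed.

(** The weight of [time_word i k.+1] exceeds that of [time_word i k] by
    [lam ord0], which turns the integrand of the recursion into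
    [exp (lam ord0 * u)] times the rescaled component of the shorter word. *)
Lemma signature_fading_tower (R : realType) (disp : measure_display)
    (Omega : measurableType disp) (P : probability Omega R) (T : R) (d : nat)
    (lam : 'I_d.+1 -> R) (X : 'I_d -> R -> {RV P >-> R})
    (S : seq 'I_d.+1 -> R -> {RV P >-> R}) (i : 'I_d) :
  efm_signature T lam (time_augmented X) S ->
  {ae P, forall w, fading_tower T (lam (lift ord0 i)) (lam ord0)
    (fun t => X i t w) (fun k t => rescaled lam S (time_word i k) t w)}.
Proof.
move=> sigS; have mX := measurable_time_augmented X.
have [S1 _ _] := sigS.
have cg : {ae P, forall w, forall k,
    {within `]-oo, T], continuous (fun t => rescaled lam S (time_word i k) t w)}}.
  by apply: ae_foralln => k; exact: continuous_rescaled sigS _.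
have g0 : {ae P, forall w, forall k,
    rescaled lam S (time_word i k) t w @[t --> -oo] --> 0}.
  apply: ae_foralln => -[|k]; last exact: rescaled_cvg_Ny mX sigS _ _.
  exact: (rescaled_cvg_Ny mX sigS [::]).
have adh0 : {ae P, forall w, forall p q : rat, ratr p < ratr q :> R ->
    ratr q < T -> trapezoid_adherent (fun u => expR (lam (lift ord0 i) * u))
      (fun t => X i t w) (ratr p) (ratr q)
      (rescaled lam S (time_word i 0) (ratr q) w -
       rescaled lam S (time_word i 0) (ratr p) w)}.
  apply: ae_forall_countable => p; apply: ae_forall_countable => q.
  have [pq|qp] := ltP (ratr p : R) (ratr q); last by apply: aeW.
  have [qT|Tq] := ltP (ratr q) T; last by apply: aeW.
  have := rescaled_increment_adherent mX sigS [::] (lift ord0 i) (ltW pq) (ltW qT).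
  apply: filterS => w adh _ _.
  have -> : (fun t => X i t w) = (time_augmented X (lift ord0 i))^~ w.
    by apply/funext => t; rewrite /time_augmented liftK.
  apply: trapezoid_adherent_eq adh => u /andP[_ uq].
  by rewrite S1 ?mulr1 ?(le_trans uq) ?ltW// /lam_word big_seq1.
have adh : {ae P, forall w, forall k (p q : rat), ratr p < ratr q :> R ->
    ratr q < T -> trapezoid_adherent
      (fun u => expR (lam ord0 * u) * rescaled lam S (time_word i k) u w) id
      (ratr p) (ratr q)
      (rescaled lam S (time_word i k.+1) (ratr q) w -
       rescaled lam S (time_word i k.+1) (ratr p) w)}.
  apply: ae_foralln => k.
  apply: ae_forall_countable => p; apply: ae_forall_countable => q.
  have [pq|qp] := ltP (ratr p : R) (ratr q); last by apply: aeW.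
  have [qT|Tq] := ltP (ratr q) T; last by apply: aeW.
  have := rescaled_increment_adherent mX sigS (time_word i k) ord0 (ltW pq) (ltW qT).
  apply: filterS => w adh _ _.
  have -> : id = (time_augmented X ord0)^~ w.
    by apply/funext => t; rewrite /time_augmented unlift_none.
  apply: trapezoid_adherent_eq adh => u _.
  have -> : lam_word lam (rcons (time_word i k) ord0) =
      lam ord0 + lam_word lam (time_word i k).
    by rewrite /lam_word -cats1 big_cat big_seq1 addrC.
  rewrite mulrDl expRD; exact/esym/mulrA.
by apply: filterS3 cg g0 (filterI adh0 adh) => w {}cg {}g0 [{}adh0 {}adh]; split.
Qed.

Theorem corollary4p7
  (R : realType) (disp : measure_display) (Omega : measurableType disp)
  (P : probability Omega R) (F : R -> set (set Omega))
  (T : R) (d : nat) (lam : 'I_d.+1 -> R)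
  (X Y : 'I_d -> R -> {RV P >-> R})
  (SX SY : seq 'I_d.+1 -> R -> {RV P >-> R}) :
  filtration_upto T F ->
  (forall j, 0 < lam j) ->
  efm_semimartingale F T lam X ->
  efm_semimartingale F T lam Y ->
  efm_signature T lam (time_augmented X) SX ->
  efm_signature T lam (time_augmented Y) SY ->
  {ae P, forall w,
    (forall v : seq 'I_d.+1, SX v T w = SY v T w) ->
    exists c : 'I_d -> R,
      forall (i : 'I_d) (t : R), t <= T -> X i t w - Y i t w = c i}.
Proof.
move=> _ lam0 [cX _] [cY _] sigX sigY.
have pathwise : {ae P, forall w, forall i : 'I_d,
    (forall v : seq 'I_d.+1, SX v T w = SY v T w) ->
    forall t, t <= T -> X i t w - Y i t w = X i T w - Y i T w}.
  apply: ae_forall_countable => i.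
  apply: filterS2 (filterI (cX i) (cY i)) (filterI
    (signature_fading_tower i sigX) (signature_fading_tower i sigY)).
  move=> w [cXw cYw] [towerX towerY] SXY.
  apply: (path_determined (lam0 _) (lam0 _) cXw cYw towerX towerY) => k.
  by rewrite /rescaled SXY.
apply: filterS pathwise => w XY SXY.
by exists (fun i => X i T w - Y i T w) => i; exact: XY.
Qed.
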